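(* Let $\mathcal X_T=(X_1,\ldots,X_T)$ be given vectors in $\mathbb R^p$ and let $\epsilon>0$. For $\lambda_1,\lambda_2>0$ and $\lambda_3\ge0.5$ let (P) and (P') be the optimization problems $$\text{(P)}\quad\min_{\Theta_t\succeq\epsilon I_p,\ 1\le t\le T}\Big\{\sum_{t=1}^T\big[\mathrm{tr}(\tfrac12\Theta_t^2X_tX_t^\top)-\mathrm{tr}(\Theta_t)\big]+\lambda_1T\sum_{t=1}^T\|\Theta_t\|_{1,\mathrm{off}}+\lambda_2T\sum_{t=1}^{T-1}\|\Theta_{t+1}-\Theta_t\|_F\Big\},$$ $$\text{(P')}\quad\min_{\Theta_t\succeq\epsilon I_p,\ 1\le t\le T}\Big\{\sum_{t=1}^T\big[\mathrm{tr}(\tfrac12\Theta_t^2X_tX_t^\top)-\mathrm{tr}(\Theta_t)\big]+\lambda_1T\sum_{t=1}^T\|\Theta_t\|_{1,\mathrm{off}}+\lambda_2T\sum_{t=1}^{T-1}\mathcal R(\|\Theta_{t+1}-\Theta_t\|_F;\lambda_3)\Big\},$$ where $\mathcal R(x;\lambda_3)=|x|$ if $|x|\le\lambda_3$ and $\mathcal R(x;\lambda_3)=x^2-\lambda_3^2+\lambda_3$ otherwise. Then: (i) For any positive $\lambda_1$ and $\lambda_2$ such that (P) has optimal solutions, there exists $\overline\lambda_3\ge0.5$ such that for any $\lambda_3\ge\overline\lambda_3$, any optimal solution of (P') also solves (P). (ii) Fix any positive $\lambda_1$ and $\lambda_2$ such that (P) does not have optimal solutions. Then for any $\lambda_3\ge0.5$,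 any optimal solution $\{\Theta^*_t\}_{t=1}^T$ to (P') satisfies $$\max_{t=1,\ldots,T-1}\|\Theta^*_{t+1}-\Theta^*_t\|_F\ge\lambda_3.$$
   Context: $\Theta_t\succeq\epsilon I_p$ means $\Theta_t$ is a symmetric $p\times p$ matrix with $\Theta_t-\epsilon I_p$ positive semi-definite. $\|A\|_{1,\mathrm{off}}=\sum_{k\ne l}|A_{kl}|$; $\|\cdot\|_F$ is the Frobenius norm. *)

(* Defs.v *)
From mathcomp Require Import all_boot all_order all_algebra.
From mathcomp Require Import reals.

Set Implicit Arguments.
Unset Strict Implicit.
Unset Printing Implicit Defensive.

Import Order.TTheory GRing.Theory Num.Theory.

Local Open Scope ring_scope.

Definition psdmx (R : realType) (p : nat) (A : 'M[R]_p) : Prop :=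
  A^T = A /\ forall v : 'cV[R]_p, 0 <= \tr (v^T *m A *m v).

Definition succeq_eps (R : realType) (p : nat) (eps : R) (A : 'M[R]_p) : Prop :=
  A^T = A /\ psdmx (A - eps%:M).

Definition l1_off (R : realType) (p : nat) (A : 'M[R]_p) : R :=
  \sum_(k < p) \sum_(l < p | k != l) `|A k l|.

Definition frob (R : realType) (p : nat) (A : 'M[R]_p) : R :=
  Num.sqrt (\sum_(k < p) \sum_(l < p) A k l ^+ 2).

Definition calR (R : realType) (lambda3 x : R) : R :=
  if `|x| <= lambda3 then `|x| else x ^+ 2 - lambda3 ^+ 2 + lambda3.

(* Times t = 1..T are encoded by 'I_T (shifted by one).  The library's [ordS]
   is the cyclic successor, so it is used only under the guard [t.+1 < T],
   where it is the true successor. *)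
Definition jump (R : realType) (p T : nat) (Theta : 'I_T -> 'M[R]_p)
    (t : 'I_T) : R :=
  frob (Theta (ordS t) - Theta t).

Definition objective (R : realType) (p T : nat) (X : 'I_T -> 'cV[R]_p)
    (lambda1 lambda2 : R) (pen : R -> R) (Theta : 'I_T -> 'M[R]_p) : R :=
  \sum_(t < T) (\tr ((1 / 2) *: (Theta t *m Theta t) *m (X t *m (X t)^T))
                - \tr (Theta t))
  + lambda1 * T%:R * (\sum_(t < T) l1_off (Theta t))
  + lambda2 * T%:R * (\sum_(t < T | (t.+1 < T)%N) pen (jump Theta t)).

Definition objP (R : realType) (p T : nat) (X : 'I_T -> 'cV[R]_p)
    (lambda1 lambda2 : R) : ('I_T -> 'M[R]_p) -> R :=
  objective X lambda1 lambda2 (fun x => x).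

Definition objP' (R : realType) (p T : nat) (X : 'I_T -> 'cV[R]_p)
    (lambda1 lambda2 lambda3 : R) : ('I_T -> 'M[R]_p) -> R :=
  objective X lambda1 lambda2 (calR lambda3).

Definition feasible (R : realType) (p T : nat) (eps : R)
    (Theta : 'I_T -> 'M[R]_p) : Prop :=
  forall t, succeq_eps eps (Theta t).

Definition optimal (R : realType) (p T : nat) (eps : R)
    (f : ('I_T -> 'M[R]_p) -> R) (Theta : 'I_T -> 'M[R]_p) : Prop :=
  feasible eps Theta /\
  forall Theta' : 'I_T -> 'M[R]_p, feasible eps Theta' -> f Theta <= f Theta'.

(* Main.v *)
(** At an optimal solution of (P') whose jumps are all below [lambda3], the
    objectives of (P) and (P') agree near that solution along any segment to a
    feasible point, so convexity of (P) turns local optimality into global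
    optimality for (P); this gives (ii). For (i), [calR lambda3 x >= x] when
    [lambda3 >= 1/2], and the two objectives agree at a given solution of (P)
    once [lambda3] exceeds its largest jump. *)

Require Import Defs.
From mathcomp Require Import all_boot all_order all_algebra.
From mathcomp Require Import reals.
From mathcomp Require Import ring lra.

Set Implicit Arguments.
Unset Strict Implicit.
Unset Printing Implicit Defensive.

Import Order.TTheory GRing.Theory Num.Theory.

Local Open Scope ring_scope.

(** With [P], [S], [Q] as set below, the non-negative sum of [(Q * x i - P * y i) ^+ 2] equals
    [Q * (S * Q - P ^+ 2)]; dividing by [Q] requires [Q != 0], and [Q = 0] forces every [y i] to
    vanish. *)
Lemma cauchy_schwarz_sum (R : realType) (I : finType) (x y : I -> R) :
  (\sum_i x i * y i) ^+ 2 <= (\sum_i x i ^+ 2) * (\sum_i y i ^+ 2).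
Proof.
set P := \sum_i x i * y i; set S := \sum_i x i ^+ 2; set Q := \sum_i y i ^+ 2.
have Q_ge0 : 0 <= Q by apply: sumr_ge0 => i _; exact: sqr_ge0.
have [Q0|Q_neq0] := eqVneq Q 0.
  have y0 i : y i = 0.
    apply/eqP; rewrite -sqrf_eq0; apply/eqP.
    by apply: (psumr_eq0P _ Q0) => // j _; exact: sqr_ge0.
  by rewrite /P Q0 mulr0 big1 ?expr0n // => i _; rewrite y0 mulr0.
have Q_gt0 : 0 < Q by rewrite lt_def Q_neq0.
have : 0 <= \sum_i (Q * x i - P * y i) ^+ 2.
  by apply: sumr_ge0 => i _; exact: sqr_ge0.
have -> : \sum_i (Q * x i - P * y i) ^+ 2 = Q * (S * Q - P ^+ 2).
  transitivity (\sum_i (Q ^+ 2 * x i ^+ 2 - 2 * Q * P * (x i * y i)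
                        + P ^+ 2 * y i ^+ 2)).
    by apply: eq_bigr => i _; ring.
  rewrite big_split /= sumrB -!mulr_sumr -/P -/S -/Q; ring.
by rewrite pmulr_rge0 // subr_ge0.
Qed.

(** After squaring, the two sides differ only in the cross term, which Cauchy-Schwarz bounds. *)
Lemma l2norm_convex (R : realType) (I : finType) (x y : I -> R) (s : R) :
  0 <= s -> s <= 1 ->
  Num.sqrt (\sum_i ((1 - s) * x i + s * y i) ^+ 2) <=
  (1 - s) * Num.sqrt (\sum_i x i ^+ 2) + s * Num.sqrt (\sum_i y i ^+ 2).
Proof.
move=> s0 s1; have s1' : 0 <= 1 - s by rewrite subr_ge0.
set S := \sum_i x i ^+ 2; set Q := \sum_i y i ^+ 2.
have S_ge0 : 0 <= S by apply: sumr_ge0 => i _; exact: sqr_ge0.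
have Q_ge0 : 0 <= Q by apply: sumr_ge0 => i _; exact: sqr_ge0.
have PSQ : \sum_i x i * y i <= Num.sqrt S * Num.sqrt Q.
  rewrite -sqrtrM //; apply: le_trans (ler_norm _) _.
  by rewrite -sqrtr_sqr ler_wsqrtr // cauchy_schwarz_sum.
have rhs_ge0 : 0 <= (1 - s) * Num.sqrt S + s * Num.sqrt Q.
  by rewrite addr_ge0 // mulr_ge0 // sqrtr_ge0.
rewrite -[leRHS]ger0_norm // -sqrtr_sqr ler_wsqrtr //.
have -> : \sum_i ((1 - s) * x i + s * y i) ^+ 2 =
    (1 - s) ^+ 2 * S + 2 * ((1 - s) * s) * (\sum_i x i * y i) + s ^+ 2 * Q.
  rewrite !mulr_sumr -!big_split; apply: eq_bigr => i _ /=; ring.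
have -> : ((1 - s) * Num.sqrt S + s * Num.sqrt Q) ^+ 2 =
    (1 - s) ^+ 2 * S + 2 * ((1 - s) * s) * (Num.sqrt S * Num.sqrt Q)
    + s ^+ 2 * Q.
  rewrite -{2}(sqr_sqrtr S_ge0) -{3}(sqr_sqrtr Q_ge0); ring.
by rewrite lerD2r lerD2l ler_wpM2l // !mulr_ge0.
Qed.

Section Convexity.
Variables (R : realType) (p : nat) (s : R).
Hypotheses (s_ge0 : 0 <= s) (s_le1 : s <= 1).
Implicit Types A B : 'M[R]_p.

Let s1_ge0 : 0 <= 1 - s. Proof. by rewrite subr_ge0. Qed.

Lemma frob_convex A B :
  frob ((1 - s) *: A + s *: B) <= (1 - s) * frob A + s * frob B.
Proof.
have frobE C : frob C = Num.sqrt (\sum_(i : 'I_p * 'I_p) C i.1 i.2 ^+ 2).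
  by rewrite /frob pair_bigA.
rewrite !frobE; under eq_bigr do rewrite !mxE.
exact: l2norm_convex.
Qed.

Lemma l1_off_convex A B :
  l1_off ((1 - s) *: A + s *: B) <= (1 - s) * l1_off A + s * l1_off B.
Proof.
rewrite /l1_off !mulr_sumr -big_split; apply: ler_sum => k _ /=.
rewrite !mulr_sumr -big_split; apply: ler_sum => l _ /=.
rewrite !mxE; apply: le_trans (ler_normD _ _) _.
by rewrite !normrM (ger0_norm s_ge0) (ger0_norm s1_ge0).
Qed.

(** Cyclicity of the trace and symmetry of [A] expose the loss as half the squared norm of [A *m x],
    so its convexity reduces to that of the square function. *)
Lemma trace_quad_sym A (x : 'cV[R]_p) : A^T = A ->
  \tr ((1 / 2) *: (A *m A) *m (x *m x^T)) =
  1 / 2 * \sum_k (A *m x) k 0 ^+ 2.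
Proof.
move=> sA; rewrite -scalemxAl mxtraceZ; congr (_ * _).
rewrite mulmxA mxtrace_mulC.
have -> : x^T *m (A *m A *m x) = (A *m x)^T *m (A *m x).
  by rewrite trmx_mul sA !mulmxA.
rewrite /mxtrace big_ord1 mxE; apply: eq_bigr => k _.
by rewrite mxE expr2.
Qed.

Lemma trace_quad_convex A B (x : 'cV[R]_p) : A^T = A -> B^T = B ->
  let C := (1 - s) *: A + s *: B in
  \tr ((1 / 2) *: (C *m C) *m (x *m x^T)) <=
  (1 - s) * \tr ((1 / 2) *: (A *m A) *m (x *m x^T)) +
  s * \tr ((1 / 2) *: (B *m B) *m (x *m x^T)).
Proof.
move=> sA sB /=; set C := _ + s *: B.
have sC : C^T = C by rewrite /C linearD !linearZ /= sA sB.
rewrite !trace_quad_sym // !mulr_sumr -big_split; apply: ler_sum => k _ /=.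
rewrite /C mulmxDl -!scalemxAl !mxE.
set a := \sum_j _; set b := \sum_j _.
(* This is the convexity gap of the square: [(1 - s) * a ^+ 2 + s * b ^+ 2 - ((1 - s) * a + s * b)
   ^+ 2]. *)
have := mulr_ge0 (mulr_ge0 s_ge0 s1_ge0) (sqr_ge0 (a - b)).
nra.
Qed.

Lemma succeq_eps_convex (eps : R) A B :
  succeq_eps eps A -> succeq_eps eps B ->
  succeq_eps eps ((1 - s) *: A + s *: B).
Proof.
move=> [sA [_ pA]] [sB [_ pB]].
have sC : ((1 - s) *: A + s *: B)^T = (1 - s) *: A + s *: B.
  by rewrite linearD !linearZ /= sA sB.
split=> //; split; first by rewrite linearB /= sC tr_scalar_mx.
move=> v.
(* The weights sum to one, so the shift by [eps] distributes over both terms. *)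
have -> : (1 - s) *: A + s *: B - eps%:M =
    (1 - s) *: (A - eps%:M) + s *: (B - eps%:M).
  by apply/matrixP => i j; rewrite !mxE; ring.
rewrite mulmxDr mulmxDl -!scalemxAr -!scalemxAl mxtraceD !mxtraceZ.
by rewrite addr_ge0 // mulr_ge0.
Qed.

Variables (T : nat) (Theta Theta' : 'I_T -> 'M[R]_p).

Let mix t := (1 - s) *: Theta t + s *: Theta' t.

Lemma jump_convex t :
  jump mix t <= (1 - s) * jump Theta t + s * jump Theta' t.
Proof.
rewrite /jump; have -> : mix (ordS t) - mix t =
    (1 - s) *: (Theta (ordS t) - Theta t) + s *: (Theta' (ordS t) - Theta' t).
  by apply/matrixP => i j; rewrite !mxE; ring.
exact: frob_convex.
Qed.

Lemma objP_convex (X : 'I_T -> 'cV[R]_p) (eps lambda1 lambda2 : R) :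
  0 <= lambda1 -> 0 <= lambda2 -> feasible eps Theta -> feasible eps Theta' ->
  objP X lambda1 lambda2 mix <=
  (1 - s) * objP X lambda1 lambda2 Theta + s * objP X lambda1 lambda2 Theta'.
Proof.
move=> l1 l2 fT fT'; rewrite /objP /objective.
have convex_sum (P : pred 'I_T) (f g h : 'I_T -> R) (c : R) : 0 <= c ->
    (forall t, f t <= (1 - s) * g t + s * h t) ->
    c * \sum_(t | P t) f t <=
    (1 - s) * (c * \sum_(t | P t) g t) + s * (c * \sum_(t | P t) h t).
  move=> c0 fgh; rewrite (mulrCA (1 - s)) (mulrCA s) -mulrDr ler_wpM2l //.
  by rewrite !mulr_sumr -big_split; apply: ler_sum.
have regroup (a b c d e f : R) : (1 - s) * (a + b + c) + s * (d + e + f) =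
    ((1 - s) * a + s * d) + ((1 - s) * b + s * e) + ((1 - s) * c + s * f).
  by ring.
rewrite regroup; apply: lerD; first apply: lerD.
- rewrite !mulr_sumr -big_split; apply: ler_sum => t _ /=.
  have [sA _] := fT t; have [sB _] := fT' t.
  have := trace_quad_convex (X t) sA sB.
  rewrite /= !mxtraceD !mxtraceZ /mix; lra.
- by apply: convex_sum => [|t]; [rewrite mulr_ge0 | exact: l1_off_convex].
- by apply: convex_sum => [|t]; [rewrite mulr_ge0 | exact: jump_convex].
Qed.

End Convexity.

Section Penalty.
Variables (R : realType) (p T : nat) (X : 'I_T -> 'cV[R]_p).
Variables (lambda1 lambda2 lambda3 : R).
Implicit Types Theta : 'I_T -> 'M[R]_p.

Lemma jump_ge0 Theta t : 0 <= jump Theta t.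
Proof. exact: sqrtr_ge0. Qed.

(** For [x > lambda3] the gap factors as [(x - lambda3) * (x + lambda3 - 1)], and the bound 1/2
    makes the second factor positive; for [x < - lambda3] the penalty is positive and [x]
    negative. *)
Lemma le_calR x : 1 / 2 <= lambda3 -> x <= calR lambda3 x.
Proof.
move=> l3; rewrite /calR; case: ifPn => [_|]; first exact: ler_norm.
by case: (ger0P x) => x0; rewrite -ltNge => l3x; nra.
Qed.

Lemma objP_le_objP' Theta : 0 <= lambda2 -> 1 / 2 <= lambda3 ->
  objP X lambda1 lambda2 Theta <= objP' X lambda1 lambda2 lambda3 Theta.
Proof.
move=> l2 l3; rewrite lerD2l ler_wpM2l ?mulr_ge0 //.
by apply: ler_sum => t _; exact: le_calR.
Qed.

Lemma objP'_eq_objP Theta :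
  (forall t : 'I_T, (t.+1 < T)%N -> jump Theta t <= lambda3) ->
  objP' X lambda1 lambda2 lambda3 Theta = objP X lambda1 lambda2 Theta.
Proof.
move=> small; congr (_ + _ * _); apply: eq_bigr => t tT.
by rewrite /calR ger0_norm ?jump_ge0 // small.
Qed.

End Penalty.

Lemma optimalP'_small_jumps (R : realType) (p T : nat) (X : 'I_T -> 'cV[R]_p)
    (eps lambda1 lambda2 lambda3 : R) (Theta : 'I_T -> 'M[R]_p) :
  0 <= lambda1 -> 0 <= lambda2 -> 1 / 2 <= lambda3 ->
  optimal eps (objP' X lambda1 lambda2 lambda3) Theta ->
  \big[Num.max/0]_(t < T | (t.+1 < T)%N) jump Theta t < lambda3 ->
  optimal eps (objP X lambda1 lambda2) Theta.
Proof.
move=> l1 l2 l3 [fT minT]; set M := \big[_/_]_(_ | _) _ => M_lt.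
split=> // Theta' fT'.
pose N : R := \big[Num.max/0]_(t < T | (t.+1 < T)%N) jump Theta' t.
have N_ge0 : 0 <= N by exact: bigmax_ge_id.
have M_ge0 : 0 <= M by exact: bigmax_ge_id.
have den_gt0 : 0 < lambda3 - M + N by lra.
(* With this weight the segment from [Theta] stays in the region where every
   jump is at most [lambda3]. *)
pose s := (lambda3 - M) / (lambda3 - M + N).
have sE : s * (lambda3 - M + N) = lambda3 - M by rewrite divfK ?gt_eqF.
(* Strictness of [M < lambda3] enters here; the final cancellation of [s] depends on it. *)
have s_gt0 : 0 < s by rewrite divr_gt0 // subr_gt0.
have s_le1 : s <= 1 by rewrite ler_pdivrMr // mul1r lerDl.
have s_ge0 := ltW s_gt0.
pose mix t := (1 - s) *: Theta t + s *: Theta' t.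
have fmix : feasible eps mix by move=> t; exact: succeq_eps_convex.
have jump_mix (t : 'I_T) : (t.+1 < T)%N -> jump mix t <= lambda3.
  move=> tT; apply: le_trans (jump_convex s_ge0 s_le1 Theta Theta' t) _.
  have jM : jump Theta t <= M by apply: le_bigmax_cond.
  have jN : jump Theta' t <= N by apply: le_bigmax_cond.
  have : (1 - s) * jump Theta t <= (1 - s) * M by rewrite ler_wpM2l // subr_ge0.
  have : s * jump Theta' t <= s * N by rewrite ler_wpM2l.
  (* By [sE], [(1 - s) * M + s * N] equals [(1 - s) * lambda3]. *)
  nra.
(* Writing P and P' for the objectives: P([Theta]) <= P'([Theta]) <= P'([mix]) = P([mix]) <= (1 - s)
   P([Theta]) + s P([Theta']). *)
have := minT _ fmix; rewrite (objP'_eq_objP _ _ _ jump_mix).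
have := objP_le_objP' X lambda1 Theta l2 l3.
have := objP_convex s_ge0 s_le1 X l1 l2 fT fT'; rewrite -/mix => h1 h2 h3.
have : s * objP X lambda1 lambda2 Theta <= s * objP X lambda1 lambda2 Theta'.
  lra.
by rewrite ler_pM2l.
Qed.

Theorem proposition4p3 (R : realType) (p T : nat) (X : 'I_T -> 'cV[R]_p)
    (eps : R) (heps : 0 < eps) :
  (forall lambda1 lambda2 : R, 0 < lambda1 -> 0 < lambda2 ->
     (exists Theta, optimal eps (objP X lambda1 lambda2) Theta) ->
     exists lambda3bar : R, 1 / 2 <= lambda3bar /\
       forall lambda3 : R, lambda3bar <= lambda3 ->
       forall Theta, optimal eps (objP' X lambda1 lambda2 lambda3) Theta ->
         optimal eps (objP X lambda1 lambda2) Theta)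
  /\
  (forall lambda1 lambda2 : R, 0 < lambda1 -> 0 < lambda2 ->
     ~ (exists Theta, optimal eps (objP X lambda1 lambda2) Theta) ->
     forall lambda3 : R, 1 / 2 <= lambda3 ->
     forall Theta, optimal eps (objP' X lambda1 lambda2 lambda3) Theta ->
       lambda3 <= \big[Num.max/0]_(t < T | (t.+1 < T)%N) jump Theta t).
Proof.
split=> lambda1 lambda2 /ltW l1 /ltW l2.
  move=> [Opt [fOpt minOpt]].
  pose M : R := \big[Num.max/0]_(t < T | (t.+1 < T)%N) jump Opt t.
  (* The threshold comes from one fixed solution [Opt] of (P), so it serves every solution of (P')
     at once. *)
  exists (Num.max (1 / 2) M); split=> [|lambda3]; first by rewrite le_max lexx.
  rewrite ge_max => /andP[l3 M_le] Theta [fT minT]; split=> // Theta' fT'.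
  (* The chain is P([Theta]) <= P'([Theta]) <= P'([Opt]) = P([Opt]) <= P([Theta']). *)
  apply: le_trans (objP_le_objP' X lambda1 Theta l2 l3) _.
  apply: le_trans (minT _ fOpt) _; rewrite objP'_eq_objP; first exact: minOpt.
  by move=> t tT; apply: le_trans M_le; apply: le_bigmax_cond.
move=> noOpt lambda3 l3 Theta optT; rewrite leNgt; apply/negP => small.
by apply: noOpt; exists Theta; exact: optimalP'_small_jumps small.
Qed.
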